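(* For any $0<\alpha<T/2$ and any $\varepsilon>0$ there exists $B_0\equiv B_0(\alpha,\varepsilon)>0$ such that, for every extremal (as defined in the context) with total emission $B=x_2(T)+x_3(T)\ge B_0$, the inequality $$\Bigl|x_1(t)-\frac12\Bigr|<\varepsilon$$ holds for all $t\in[\alpha,T-\alpha]$.
   Context: Fix constants $\lambda,\mu,\nu>0$ and $T>0$. An extremal is a tuple of $C^1$ functions $(x_1,x_2,x_3,\varkappa_1,\varkappa_2,\varkappa_3)$ on $[0,T]$ solving the Hamiltonian system $$\begin{aligned}\dot x_1&=\lambda(1-x_1)e^{\varkappa_1}-\mu x_1e^{-\varkappa_1+\varkappa_2}-\nu x_1e^{-\varkappa_1+2\varkappa_3},\\ \dot x_2&=\mu x_1e^{-\varkappa_1+\varkappa_2},\\ \dot x_3&=2\nu x_1e^{-\varkappa_1+2\varkappa_3},\\ \dot\varkappa_1&=\lambda e^{\varkappa_1}-\mu e^{-\varkappa_1+\varkappa_2}-\nu e^{-\varkappa_1+2\varkappa_3}-\lambda+\mu+\nu,\\ \dot\varkappa_2&=0,\qquad \dot\varkappa_3=0\end{aligned}$$ (so $\varkappa_2,\varkappa_3$ are real constants), with boundary conditions $x_2(0)=x_3(0)=0$, $\varkappa_1(T)=0$, and $0\le x_1(t)\le 1$ on $[0,T]$; the value $x_1(0)\in[0,1]$ is a parameter. This is the system that determines the optimal path (minimizer of the large deviation rate function) of the scaled number $x_1$ of excited atoms, spontaneously emitted photons $x_2$ and stimulated emitted photons $x_3$, given total emission $B=x_2(T)+x_3(T)$.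 *)

(* Defs.v *)
(* Stdlib classical reals. *)
From Stdlib Require Import Reals.
Local Open Scope R_scope.

Definition time_interval (T t : R) : Prop := 0 <= t <= T.

(* Derivatives and limits are taken relative to D ([D_in], [continue_in]): for
   D = [0,T] they are one-sided at the endpoints, and values of f outside D are
   irrelevant. *)
Definition C1_on (D : R -> Prop) (f : R -> R) : Prop :=
  exists d : R -> R, forall t : R, D t -> D_in f d D t /\ continue_in d D t.

Record extremal (lambda mu nu T : R) (x1 x2 x3 k1 k2 k3 : R -> R) : Prop :=
  Extremal {
    ext_x1_C1 : C1_on (time_interval T) x1;
    ext_x2_C1 : C1_on (time_interval T) x2;
    ext_x3_C1 : C1_on (time_interval T) x3;
    ext_k1_C1 : C1_on (time_interval T) k1;
    ext_k2_C1 : C1_on (time_interval T) k2;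
    ext_k3_C1 : C1_on (time_interval T) k3;

    ext_x1_ode : forall t, time_interval T t ->
      D_in x1 (fun s => lambda * (1 - x1 s) * exp (k1 s)
                        - mu * x1 s * exp (- k1 s + k2 s)
                        - nu * x1 s * exp (- k1 s + 2 * k3 s))
           (time_interval T) t;
    ext_x2_ode : forall t, time_interval T t ->
      D_in x2 (fun s => mu * x1 s * exp (- k1 s + k2 s)) (time_interval T) t;
    ext_x3_ode : forall t, time_interval T t ->
      D_in x3 (fun s => 2 * nu * x1 s * exp (- k1 s + 2 * k3 s))
           (time_interval T) t;
    ext_k1_ode : forall t, time_interval T t ->
      D_in k1 (fun s => lambda * exp (k1 s)
                        - mu * exp (- k1 s + k2 s)
                        - nu * exp (- k1 s + 2 * k3 s)
                        - lambda + mu + nu)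
           (time_interval T) t;
    ext_k2_ode : forall t, time_interval T t ->
      D_in k2 (fun _ => 0) (time_interval T) t;
    ext_k3_ode : forall t, time_interval T t ->
      D_in k3 (fun _ => 0) (time_interval T) t;

    ext_x2_0 : x2 0 = 0;
    ext_x3_0 : x3 0 = 0;
    ext_k1_T : k1 T = 0;
    ext_x1_range : forall t, time_interval T t -> 0 <= x1 t <= 1
  }.

(* Main.v *)
Require Import Defs.
From Stdlib Require Import Reals Lra Psatz.
From Coquelicot Require Import Coquelicot.
Local Open Scope R_scope.

(** Since k2 and k3 are constant, x1 and k1 solve a planar system driven by the
    single parameter M = mu e^{k2} + nu e^{2 k3}:
      k1' = - w,   w = M e^{-k1} - lambda e^{k1} - c,   c = mu + nu - lambda,
      x1' = lambda (1 - x1) e^{k1} - M x1 e^{-k1}.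
    Differentiating w gives the key identity
      w' = g w,   g = M e^{-k1} + lambda e^{k1} >= 2 r,   r = sqrt (lambda M),
    so w^2 decays, backward from T, at rate at least 4 r; and k1(T) = 0 gives
    w(T) = M - mu - nu ([slope_sqr_growth]).

    Large M. At distance alpha from T, |w(T)| e^{-2 r alpha} is bounded
    uniformly in M, since M e^{-2 r alpha} <= 1 / (lambda alpha^2); hence |w| is
    bounded by a constant on [0, T - alpha] ([slope_layer_bound]). The deviation
    y = x1 - 1/2 satisfies y' = - (w + c) / 2 - g y: a bounded forcing against
    a damping of strength at least 2 r. After a time alpha this forces
    y^2 = O(1 / r) ([X_deviation_bound]).

    Large total emission forces large M. Because w^2 is nondecreasing,
    |k1'| <= |w(T)| <= M + mu + nu, so k1 >= - T (M + mu + nu); the emission rate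
    is at most 2 M e^{-k1}, so the total emission is at most an explicit
    increasing function of M ([emission_bound]). *)

(** * From derivatives relative to [0,T] to derivatives on the line *)

Lemma D_in_is_derive (T : R) (f d : R -> R) (t : R) :
  0 < t < T -> D_in f d (time_interval T) t -> is_derive f t (d t).
Proof.
intros Ht H; apply is_derive_Reals; intros e He.
destruct (H e He) as [a [Ha Hf]].
assert (Hd : 0 < Rmin a (Rmin t (T - t))) by (repeat apply Rmin_pos; lra).
exists (mkposreal _ Hd); intros h Hh Hha; simpl in Hha.
pose proof (Rmin_l a (Rmin t (T - t))); pose proof (Rmin_r a (Rmin t (T - t))).
pose proof (Rmin_l t (T - t)); pose proof (Rmin_r t (T - t)).
pose proof (Rle_abs h); pose proof (Rle_abs (- h)); rewrite Rabs_Ropp in *.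
specialize (Hf (t + h)); simpl in Hf; unfold Rdist in Hf.
replace (t + h - t) with h in Hf by ring.
apply Hf; split; [split; [unfold time_interval; lra | lra] | lra].
Qed.

(** Composing with [clamp T] extends a function on [0,T] by constants. The result
    is continuous on the whole line and keeps its derivatives inside (0,T), which
    is what the mean value theorem asks for. *)
Definition clamp (T t : R) : R := Rmax 0 (Rmin t T).

Lemma clamp_id (T t : R) : 0 <= t <= T -> clamp T t = t.
Proof. intros H; unfold clamp; rewrite Rmin_left, Rmax_right; lra. Qed.

Lemma clamp_range (T t : R) : 0 <= T -> time_interval T (clamp T t).
Proof.
intros H; unfold time_interval, clamp; split; [apply Rmax_l | ].
apply Rmax_lub; [exact H | apply Rmin_r].
Qed.

Lemma clamp_lipschitz (T s t : R) :
  Rabs (clamp T s - clamp T t) <= Rabs (s - t).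
Proof.
unfold clamp, Rmax, Rmin.
repeat destruct Rle_dec; unfold Rabs; repeat destruct Rcase_abs; lra.
Qed.

Lemma continuous_clamp (T : R) (f d : R -> R) :
  0 <= T -> (forall t, time_interval T t -> D_in f d (time_interval T) t) ->
  forall t, continuity_pt (fun s => f (clamp T s)) t.
Proof.
intros HT H t e He.
destruct (cont_deriv _ _ _ _ (H _ (clamp_range T t HT)) e He) as [a [Ha Hf]].
exists a; split; [exact Ha | intros s [_ Hs]].
simpl in *; unfold Rdist in *.
destruct (Req_dec (clamp T s) (clamp T t)) as [E | E].
- rewrite E, Rminus_diag, Rabs_R0; exact He.
- apply Hf; split; [split; [apply clamp_range; lra | auto] | ].
  eapply Rle_lt_trans; [apply clamp_lipschitz | exact Hs].
Qed.

Lemma is_derive_clamp (T : R) (f d : R -> R) (t : R) :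
  0 < t < T -> D_in f d (time_interval T) t ->
  is_derive (fun s => f (clamp T s)) t (d (clamp T t)).
Proof.
intros Ht H; rewrite clamp_id by lra.
apply is_derive_ext_loc with f; [ | apply D_in_is_derive with T; assumption].
assert (Hd : 0 < Rmin t (T - t)) by (apply Rmin_pos; lra).
exists (mkposreal _ Hd); intros s Hs; symmetry; f_equal.
change (Rabs (s - t) < Rmin t (T - t)) in Hs.
pose proof (Rmin_l t (T - t)); pose proof (Rmin_r t (T - t)).
apply Rabs_def2 in Hs; apply clamp_id; lra.
Qed.

(** * Comparison by the mean value theorem *)

(** Any sign of [a] is allowed: positive [a] gives forward decay, and negative [a],
    applied to the opposite of a function, gives backward decay. The inequality on
    [df] is required at the endpoints too, because the mean value point may lie
    there. *)
Lemma gronwall (f df : R -> R) (a p q : R) :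
  p <= q ->
  (forall t, p <= t <= q -> continuity_pt f t) ->
  (forall t, p < t < q -> is_derive f t (df t)) ->
  (forall t, p <= t <= q -> df t <= - a * f t) ->
  f q <= f p * exp (- a * (q - p)).
Proof.
intros Hpq Hc Hd Hle.
destruct (MVT_gen (fun t => f t * exp (a * t)) p q
            (fun t => (df t + a * f t) * exp (a * t))) as [m [Hm E]].
- rewrite Rmin_left, Rmax_right by lra; intros t Ht.
  pose proof (Hd t Ht) as Dt; auto_derive.
  + exists (df t); exact Dt.
  + change (Derive (fun x : R => f x) t) with (Derive f t).
    rewrite (is_derive_unique _ _ _ Dt); ring.
- rewrite Rmin_left, Rmax_right by lra; intros t Ht.
  apply continuity_pt_mult; [apply Hc; exact Ht | ].
  apply derivable_continuous_pt; exists (a * exp (a * t)).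
  apply is_derive_Reals; auto_derive; [exact I | ring].
- rewrite Rmin_left, Rmax_right in Hm by lra.
  pose proof (Hle m Hm) as Hs; pose proof (exp_pos (a * m)).
  assert (H1 : f q * exp (a * q) <= f p * exp (a * p)).
  { assert (0 <= - (df m + a * f m) * exp (a * m) * (q - p)); [ | lra].
    repeat apply Rmult_le_pos; lra. }
  apply Rmult_le_reg_r with (exp (a * q)); [apply exp_pos | ].
  rewrite Rmult_assoc, <- exp_plus.
  replace (- a * (q - p) + a * q) with (a * p) by ring; exact H1.
Qed.

Lemma nonincreasing_of_derivative (f df : R -> R) (p q : R) :
  p <= q ->
  (forall t, p <= t <= q -> continuity_pt f t) ->
  (forall t, p < t < q -> is_derive f t (df t)) ->
  (forall t, p <= t <= q -> df t <= 0) ->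
  f q <= f p.
Proof.
intros Hpq Hc Hd Hle.
replace (f p) with (f p * exp (- 0 * (q - p))).
- apply gronwall with df; auto; intros t Ht; specialize (Hle t Ht); lra.
- rewrite Ropp_0, Rmult_0_l, exp_0; ring.
Qed.

(** * The planar system *)

(** The pair (x1, k1), extended to the line, once the constants k2 and k3 are
    absorbed into M; here c stands for mu + nu - lambda. *)
Record reduced_extremal (lambda M c T : R) (X K : R -> R) : Prop := {
  red_X_cont : forall t, continuity_pt X t;
  red_K_cont : forall t, continuity_pt K t;
  red_X_ode : forall t, 0 < t < T ->
    is_derive X t (lambda * (1 - X t) * exp (K t) - M * X t * exp (- K t));
  red_K_ode : forall t, 0 < t < T ->
    is_derive K t (lambda * exp (K t) - M * exp (- K t) + c);
  red_X_range : forall t, 0 <= t <= T -> 0 <= X t <= 1;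
  red_K_T : K T = 0
}.

(** The opposite of the derivative of K, as a function of the value of K. *)
Definition slope (lambda M c k : R) : R := M * exp (- k) - lambda * exp k - c.

(** The relaxation rate of both equations: along a solution the slope w satisfies
    w' = rate * w, and X is damped at this same rate. *)
Definition rate (lambda M k : R) : R := M * exp (- k) + lambda * exp k.

(** The inequality between arithmetic and geometric means: the two terms of the
    rate have product lambda M = s^2. *)
Lemma rate_ge (lambda s k : R) :
  0 < lambda -> 2 * s <= rate lambda (s * s / lambda) k.
Proof.
intros Hl; unfold rate.
pose proof (exp_pos k) as Ek.
replace (s * s / lambda * exp (- k) + lambda * exp k)
  with (2 * s + (s - lambda * exp k) * (s - lambda * exp k)
                * (/ lambda * exp (- k))).
- pose proof (Rle_0_sqr (s - lambda * exp k)) as Hs; unfold Rsqr in Hs.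
  pose proof (Rinv_0_lt_compat _ Hl); pose proof (exp_pos (- k)).
  assert (0 <= (s - lambda * exp k) * (s - lambda * exp k)
               * (/ lambda * exp (- k))); [ | lra].
  apply Rmult_le_pos; [assumption | apply Rmult_le_pos; lra].
- rewrite exp_Ropp; field; lra.
Qed.

Lemma continuity_pt_exp_comp (f : R -> R) (t : R) :
  continuity_pt f t -> continuity_pt (fun s => exp (f s)) t.
Proof.
intros H; apply (continuity_pt_comp f exp); [exact H | ].
apply derivable_continuous_pt, derivable_pt_exp.
Qed.

Lemma continuity_pt_slope (lambda M c : R) (K : R -> R) (t : R) :
  continuity_pt K t -> continuity_pt (fun s => slope lambda M c (K s)) t.
Proof.
intros H; unfold slope.
repeat apply continuity_pt_minus;
  try (apply continuity_pt_const; intros ? ?; reflexivity).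
- apply continuity_pt_mult;
    [apply continuity_pt_const; intros ? ?; reflexivity | ].
  apply continuity_pt_exp_comp, continuity_pt_opp, H.
- apply continuity_pt_mult;
    [apply continuity_pt_const; intros ? ?; reflexivity | ].
  apply continuity_pt_exp_comp, H.
Qed.

(** Along a solution w' = rate * w, so (w^2)' = 2 rate w^2 >= 2 b w^2, and
    w(T) = M - lambda - c because K T = 0. *)
Lemma slope_sqr_growth (lambda M c T b : R) (X K : R -> R) :
  reduced_extremal lambda M c T X K ->
  (forall k, b <= rate lambda M k) ->
  forall t, 0 <= t <= T ->
  (slope lambda M c (K t))^2
    <= (M - lambda - c)^2 * exp (- (2 * b) * (T - t)).
Proof.
intros [_ KC _ KD _ KT] Hb t Ht.
set (w := fun s => slope lambda M c (K s)).
assert (H : - (w T)^2 <= - (w t)^2 * exp (- (- (2 * b)) * (T - t))).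
{ apply (gronwall (fun s => - (w s)^2)
           (fun s => - (2 * rate lambda M (K s) * (w s)^2))).
  - lra.
  - intros s _; apply continuity_pt_opp.
    apply continuity_pt_ext with (fun s => w s * w s); [intros; simpl; ring | ].
    apply continuity_pt_mult; apply continuity_pt_slope, KC.
  - intros s Hs; unfold w, slope.
    pose proof (KD s ltac:(lra)) as D.
    auto_derive.
    + repeat split; eexists; exact D.
    + change (Derive (fun x : R => K x) s) with (Derive K s).
      rewrite (is_derive_unique _ _ _ D); unfold rate; ring.
  - intros s _; pose proof (Hb (K s)); pose proof (pow2_ge_0 (w s)); nra. }
replace (M - lambda - c) with (w T).
- apply Rmult_le_reg_r with (exp (- (- (2 * b)) * (T - t))); [apply exp_pos | ].
  rewrite Rmult_assoc, <- exp_plus.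
  replace (- (2 * b) * (T - t) + - - (2 * b) * (T - t)) with 0 by ring.
  rewrite exp_0; fold (w t); lra.
- unfold w, slope; rewrite KT, Ropp_0, exp_0; ring.
Qed.

(** The case b = 0 of the growth estimate: |w| is largest at the final time. *)
Lemma slope_le_end (lambda M c T : R) (X K : R -> R) :
  0 < lambda -> 0 < M -> 0 <= lambda + c ->
  reduced_extremal lambda M c T X K ->
  forall t, 0 <= t <= T -> Rabs (slope lambda M c (K t)) <= M + lambda + c.
Proof.
intros Hl HM Hc HR t Ht.
assert (H : (slope lambda M c (K t))^2
            <= (M - lambda - c)^2 * exp (- (2 * 0) * (T - t))).
{ apply slope_sqr_growth with X; [exact HR | | exact Ht].
  intros k; unfold rate; pose proof (exp_pos k); pose proof (exp_pos (- k)); nra. }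
replace (- (2 * 0) * (T - t)) with 0 in H by ring; rewrite exp_0 in H.
apply Rabs_le; nra.
Qed.

Lemma reduced_K_lower_bound (lambda M c T : R) (X K : R -> R) :
  0 < lambda -> 0 < M -> 0 <= lambda + c ->
  reduced_extremal lambda M c T X K ->
  forall t, 0 <= t <= T -> - (T * (M + lambda + c)) <= K t.
Proof.
intros Hl HM Hc HR t Ht.
set (W := M + lambda + c).
assert (HW : 0 < W) by (unfold W; lra).
pose proof (slope_le_end _ _ _ _ _ _ Hl HM Hc HR) as Hw.
destruct HR as [_ KC _ KD _ KT].
assert (H : K T - W * T <= K t - W * t).
{ apply (nonincreasing_of_derivative (fun s => K s - W * s)
           (fun s => - slope lambda M c (K s) - W)).
  - lra.
  - intros s _; apply continuity_pt_minus; [apply KC | ].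
    apply continuity_pt_mult; [ | apply continuity_pt_id].
    apply continuity_pt_const; intros ? ?; reflexivity.
  - intros s Hs.
    pose proof (KD s ltac:(lra)) as D; auto_derive.
    + eexists; exact D.
    + change (Derive (fun x : R => K x) s) with (Derive K s).
      rewrite (is_derive_unique _ _ _ D); unfold slope; ring.
  - intros s Hs; specialize (Hw s ltac:(lra)); fold W in Hw.
    apply Rabs_le_between in Hw; lra. }
rewrite KT in H; nra.
Qed.

Lemma exp_le (x y : R) : x <= y -> exp x <= exp y.
Proof.
intros [H | ->]; [apply Rlt_le, exp_increasing, H | apply Rle_refl].
Qed.

Lemma sqr_mult_exp_le (z : R) : 0 <= z -> z * z * exp (- (2 * z)) <= 1.
Proof.
intros Hz.
pose proof (exp_ineq1_le z); pose proof (exp_pos (- z)) as E.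
assert (H1 : z * exp (- z) <= 1).
{ rewrite <- exp_0, <- (Rplus_opp_r z), exp_plus.
  apply Rmult_le_compat_r; lra. }
replace (- (2 * z)) with (- z + - z) by ring; rewrite exp_plus.
replace (z * z * (exp (- z) * exp (- z)))
  with ((z * exp (- z)) * (z * exp (- z))) by ring.
assert (0 <= z * exp (- z)) by (apply Rmult_le_pos; lra); nra.
Qed.

(** The bound does not involve r: the final value of w is of order M = r^2 / lambda,
    while the decay factor over a time al is exp (- 2 r al), which is at most
    1 / (r al)^2. *)
Lemma slope_layer_bound (lambda r c T al : R) (X K : R -> R) :
  0 < lambda -> 0 < r -> 0 <= lambda + c -> 0 < al ->
  reduced_extremal lambda (r * r / lambda) c T X K ->
  forall t, 0 <= t <= T - al ->
  Rabs (slope lambda (r * r / lambda) c (K t))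
    <= / (lambda * (al * al)) + (lambda + c).
Proof.
intros Hl Hr Hc Hal HR t Ht.
set (M := r * r / lambda) in *.
assert (HM : 0 < M) by (unfold M; apply Rdiv_lt_0_compat; nra).
pose proof (slope_sqr_growth _ _ _ _ (2 * r) _ _ HR
  (fun k => rate_ge lambda r k Hl) t ltac:(lra)) as H.
set (e := exp (- (2 * (r * al)))).
assert (He : 0 < e <= 1).
{ unfold e; split; [apply exp_pos | ].
  rewrite <- exp_0; apply exp_le; nra. }
assert (Hee : exp (- (2 * (2 * r)) * (T - t)) <= e * e).
{ unfold e; rewrite <- exp_plus; apply exp_le; nra. }
assert (HMe : M * e <= / (lambda * (al * al))).
{ pose proof (sqr_mult_exp_le (r * al)
    ltac:(apply Rmult_le_pos; lra)) as Hz; fold e in Hz.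
  replace (M * e) with ((r * al * (r * al) * e) * / (lambda * (al * al)))
    by (unfold M; field; lra).
  rewrite <- (Rmult_1_l (/ _)) at 2.
  apply Rmult_le_compat_r; [ | exact Hz].
  apply Rlt_le, Rinv_0_lt_compat; repeat apply Rmult_lt_0_compat; lra. }
assert (Hs : (slope lambda M c (K t))^2 <= ((M - lambda - c) * e)^2).
{ eapply Rle_trans; [exact H | ].
  rewrite Rpow_mult_distr; apply Rmult_le_compat_l; [apply pow2_ge_0 | ].
  simpl; lra. }
assert (Hb : Rabs ((M - lambda - c) * e) <= (M + (lambda + c)) * e).
{ apply Rabs_le; nra. }
apply Rle_trans with ((M + (lambda + c)) * e); [ | nra].
eapply Rle_trans; [ | exact Hb].
apply Rsqr_le_abs_0; unfold Rsqr; lra.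
Qed.

(** With y = X - 1/2 one has y' = - (w + c) / 2 - rate * y. On [0, T - al] the
    forcing |w + c| is at most a constant B, and |y| <= 1/2, so
    (y^2)' <= B / 2 - 4 r y^2: y^2 relaxes to B / (8 r) at rate 4 r. What is left
    of the initial value after time al is at most exp (- 4 r al) / 4, again
    of order 1 / r. *)
Lemma X_deviation_bound (lambda r c T al : R) (X K : R -> R) :
  0 < lambda -> 0 < r -> 0 <= lambda + c -> 0 < al ->
  reduced_extremal lambda (r * r / lambda) c T X K ->
  forall t, al <= t <= T - al ->
  (X t - 1 / 2)^2
    <= ((/ (lambda * (al * al)) + (lambda + c) + Rabs c) / 8
        + / (16 * al)) / r.
Proof.
intros Hl Hr Hc Hal HR t Ht.
set (M := r * r / lambda) in *.
set (B := / (lambda * (al * al)) + (lambda + c) + Rabs c).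
pose proof (slope_layer_bound _ _ _ _ _ _ _ Hl Hr Hc Hal HR) as Hw.
fold M in Hw.
destruct HR as [XC KC XD KD XR KT].
set (y := fun s => X s - 1 / 2).
assert (HB : 0 <= B).
{ unfold B; pose proof (Rabs_pos c).
  assert (0 < / (lambda * (al * al)))
    by (apply Rinv_0_lt_compat; repeat apply Rmult_lt_0_compat; lra).
  lra. }
assert (HBr : 0 <= B / (8 * r)) by (apply Rdiv_le_0_compat; lra).
assert (G : (y t)^2 - B / (8 * r)
            <= ((y 0)^2 - B / (8 * r)) * exp (- (4 * r) * (t - 0))).
{ apply (gronwall (fun s => (y s)^2 - B / (8 * r))
     (fun s => - (slope lambda M c (K s) + c) * y s
               - 2 * rate lambda M (K s) * (y s)^2)).
  - lra.
  - intros s _; unfold y; apply continuity_pt_minus;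
      [ | apply continuity_pt_const; intros ? ?; reflexivity].
    apply continuity_pt_ext with (fun s => (X s - 1 / 2) * (X s - 1 / 2));
      [intros; simpl; ring | ].
    apply continuity_pt_mult; apply continuity_pt_minus;
      try apply XC; apply continuity_pt_const; intros ? ?; reflexivity.
  - intros s Hs; pose proof (XD s ltac:(lra)) as D; unfold y; auto_derive.
    + eexists; exact D.
    + change (Derive (fun x : R => X x) s) with (Derive X s).
      rewrite (is_derive_unique _ _ _ D); unfold slope, rate; field.
  - intros s Hs.
    specialize (Hw s ltac:(lra)); specialize (XR s ltac:(lra)).
    pose proof (rate_ge lambda r (K s) Hl) as Hg; fold M in Hg.
    assert (Hwc : Rabs (slope lambda M c (K s) + c) <= B).
    { eapply Rle_trans; [apply Rabs_triang | ]; unfold B; lra. }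
    assert (Hy : Rabs (y s) <= 1 / 2) by (unfold y; apply Rabs_le; lra).
    assert (H1 : - (slope lambda M c (K s) + c) * y s <= B * (1 / 2)).
    { eapply Rle_trans; [apply Rle_abs | ].
      rewrite Rabs_mult, Rabs_Ropp.
      apply Rmult_le_compat; auto using Rabs_pos. }
    assert (H2 : 2 * r * (y s)^2 <= rate lambda M (K s) * (y s)^2)
      by (apply Rmult_le_compat_r; [apply pow2_ge_0 | exact Hg]).
    replace (- (4 * r) * ((y s)^2 - B / (8 * r)))
      with (B * (1 / 2) - 4 * r * (y s)^2) by (field; lra).
    lra. }
assert (H0 : (y 0)^2 - B / (8 * r) <= 1 / 4).
{ specialize (XR 0 ltac:(lra)); unfold y; nra. }
assert (He : exp (- (4 * r) * (t - 0)) <= / (4 * r * al)).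
{ assert (0 < 4 * r * al) by nra.
  replace (- (4 * r) * (t - 0)) with (- (4 * r * t)) by ring.
  rewrite exp_Ropp; apply Rinv_le_contravar; [assumption | ].
  pose proof (exp_ineq1_le (4 * r * t)); nra. }
pose proof (exp_pos (- (4 * r) * (t - 0))).
fold (y t).
replace ((B / 8 + / (16 * al)) / r)
  with (B / (8 * r) + 1 / 4 * / (4 * r * al)) by (field; lra).
nra.
Qed.

(** * Extremals and the planar system *)

Lemma constant_of_zero_derivative (T : R) (k : R -> R) :
  (forall t, time_interval T t ->
     D_in k (fun _ => 0) (time_interval T) t) ->
  forall t, time_interval T t -> k t = k 0.
Proof.
intros D t Ht; unfold time_interval in Ht.
set (k' := fun s => k (clamp T s)).
assert (KC : forall s, continuity_pt k' s)
  by (apply continuous_clamp with (fun _ => 0); [lra | exact D]).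
assert (KD : forall s, 0 < s < t -> is_derive k' s 0)
  by (intros s Hs; apply (is_derive_clamp T k (fun _ => 0));
      [lra | apply D; unfold time_interval; lra]).
assert (H1 : k' t <= k' 0)
  by (apply nonincreasing_of_derivative with (fun _ => 0); intros; auto; lra).
assert (H2 : - k' t <= - k' 0).
{ apply (nonincreasing_of_derivative (fun s => - k' s) (fun _ => - 0)); intros;
    try lra.
  - apply continuity_pt_opp, KC.
  - apply (is_derive_opp k'), KD; assumption. }
unfold k' in *; rewrite !clamp_id in * by lra; lra.
Qed.

Lemma extremal_reduces (lambda mu nu T : R) (x1 x2 x3 k1 k2 k3 : R -> R) :
  0 < T ->
  extremal lambda mu nu T x1 x2 x3 k1 k2 k3 ->
  reduced_extremal lambda (mu * exp (k2 0) + nu * exp (2 * k3 0))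
    (mu + nu - lambda) T
    (fun s => x1 (clamp T s)) (fun s => k1 (clamp T s)).
Proof.
intros HT [_ _ _ _ _ _ D1 _ _ DK D2 D3 _ _ KT XR].
pose proof (constant_of_zero_derivative T k2 D2) as E2.
pose proof (constant_of_zero_derivative T k3 D3) as E3.
constructor.
- eapply continuous_clamp; [lra | exact D1].
- eapply continuous_clamp; [lra | exact DK].
- intros t Ht; evar_last.
  + eapply is_derive_clamp; [exact Ht | apply D1; unfold time_interval; lra].
  + simpl; rewrite E2, E3, !exp_plus by (apply clamp_range; lra); ring.
- intros t Ht; evar_last.
  + eapply is_derive_clamp; [exact Ht | apply DK; unfold time_interval; lra].
  + simpl; rewrite E2, E3, !exp_plus by (apply clamp_range; lra); ring.
- intros t Ht; apply XR, clamp_range; lra.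
- rewrite clamp_id; [exact KT | lra].
Qed.

(** The emission rate is at most 2 M e^{-k1} because x1 <= 1, with factor 2
    since x3 enters with weight 2; and e^{-k1} is controlled by the lower
    bound on k1. *)
Lemma emission_bound (lambda mu nu T : R) (x1 x2 x3 k1 k2 k3 : R -> R) :
  0 < lambda -> 0 < mu -> 0 < nu -> 0 < T ->
  extremal lambda mu nu T x1 x2 x3 k1 k2 k3 ->
  let M := mu * exp (k2 0) + nu * exp (2 * k3 0) in
  x2 T + x3 T <= 2 * M * exp (T * (M + (mu + nu))) * T.
Proof.
intros Hl Hmu Hnu HT HE M.
pose proof (extremal_reduces _ _ _ _ _ _ _ _ _ _ HT HE) as HR; fold M in HR.
assert (HM : 0 < M).
{ unfold M; apply Rplus_lt_0_compat; apply Rmult_lt_0_compat;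
    auto using exp_pos. }
assert (Hc : 0 <= lambda + (mu + nu - lambda)) by lra.
pose proof (reduced_K_lower_bound _ _ _ _ _ _ Hl HM Hc HR) as HK.
destruct HE as [_ _ _ _ _ _ _ DX2 DX3 _ D2 D3 X20 X30 _ XR].
pose proof (constant_of_zero_derivative T k2 D2) as E2.
pose proof (constant_of_zero_derivative T k3 D3) as E3.
set (b := 2 * M * exp (T * (M + (mu + nu)))).
set (S2 := fun s => x2 (clamp T s)); set (S3 := fun s => x3 (clamp T s)).
assert (H : S2 T + S3 T - b * T <= S2 0 + S3 0 - b * 0).
{ apply (nonincreasing_of_derivative (fun s => S2 s + S3 s - b * s)
    (fun s => x1 (clamp T s) * exp (- k1 (clamp T s))
              * (mu * exp (k2 0) + 2 * (nu * exp (2 * k3 0))) - b)).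
  - lra.
  - intros s _; apply continuity_pt_minus; [apply continuity_pt_plus | ].
    + eapply continuous_clamp; [lra | exact DX2].
    + eapply continuous_clamp; [lra | exact DX3].
    + apply continuity_pt_mult; [ | apply continuity_pt_id].
      apply continuity_pt_const; intros ? ?; reflexivity.
  - intros s Hs.
    assert (Is : time_interval T s) by (unfold time_interval; lra).
    pose proof (is_derive_clamp _ _ _ _ Hs (DX2 s Is)
      : is_derive S2 s _) as F2.
    pose proof (is_derive_clamp _ _ _ _ Hs (DX3 s Is)
      : is_derive S3 s _) as F3.
    auto_derive.
    { split; [eexists; exact F2 | split; [eexists; exact F3 | exact I]]. }
    change (Derive (fun x : R => S2 x) s) with (Derive S2 s).
    change (Derive (fun x : R => S3 x) s) with (Derive S3 s).
    rewrite (is_derive_unique _ _ _ F2), (is_derive_unique _ _ _ F3).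
    rewrite E2, E3, !exp_plus by (apply clamp_range; lra); ring.
  - intros s Hs; specialize (HK s Hs).
    pose proof (XR _ (clamp_range T s ltac:(lra))) as Hx.
    assert (He : exp (- k1 (clamp T s)) <= exp (T * (M + (mu + nu))))
      by (apply exp_le; replace (mu + nu) with (lambda + (mu + nu - lambda))
            by ring; lra).
    pose proof (exp_pos (- k1 (clamp T s))) as Hp.
    assert (Hm : 0 < nu * exp (2 * k3 0)
                 /\ 0 < mu * exp (k2 0) + 2 * (nu * exp (2 * k3 0)) <= 2 * M).
    { pose proof (Rmult_lt_0_compat _ _ Hnu (exp_pos (2 * k3 0))).
      pose proof (Rmult_lt_0_compat _ _ Hmu (exp_pos (k2 0))).
      unfold M; lra. }
    assert (x1 (clamp T s) * exp (- k1 (clamp T s))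
              * (mu * exp (k2 0) + 2 * (nu * exp (2 * k3 0))) <= b); [ | lra].
    unfold b; rewrite (Rmult_comm (2 * M)).
    apply Rmult_le_compat; [apply Rmult_le_pos; lra | lra | | lra].
    eapply Rle_trans; [ | exact He].
    rewrite <- (Rmult_1_l (exp _)) at 2; apply Rmult_le_compat_r; lra. }
unfold S2, S3 in H; rewrite !clamp_id in H by lra.
rewrite X20, X30 in H; lra.
Qed.

Theorem theorem6p1 :
  forall lambda mu nu T : R,
    0 < lambda -> 0 < mu -> 0 < nu -> 0 < T ->
  forall alpha eps : R,
    0 < alpha -> alpha < T / 2 -> 0 < eps ->
  exists B0 : R, 0 < B0 /\
    forall x1 x2 x3 k1 k2 k3 : R -> R,
      extremal lambda mu nu T x1 x2 x3 k1 k2 k3 ->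
      x2 T + x3 T >= B0 ->
      forall t : R, alpha <= t <= T - alpha -> Rabs (x1 t - 1 / 2) < eps.
Proof.
intros lambda mu nu T Hl Hmu Hnu HT alpha eps Hal _ Heps.
set (c := mu + nu - lambda).
set (C := (/ (lambda * (alpha * alpha)) + (lambda + c) + Rabs c) / 8
          + / (16 * alpha)).
assert (HC : 0 < C).
{ pose proof (Rabs_pos c).
  assert (0 < / (16 * alpha)) by (apply Rinv_0_lt_compat; lra).
  assert (0 < / (lambda * (alpha * alpha)))
    by (apply Rinv_0_lt_compat; repeat apply Rmult_lt_0_compat; lra).
  unfold C, c in *; lra. }
(* The threshold at which the deviation bound C / r equals eps^2; M0 is the
   corresponding value of M = r^2 / lambda. *)
set (r0 := C / (eps * eps)).
assert (Hr0 : 0 < r0)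
  by (unfold r0; apply Rdiv_lt_0_compat; [lra | apply Rmult_lt_0_compat; lra]).
set (M0 := r0 * r0 / lambda).
assert (HM0 : 0 < M0) by (unfold M0; apply Rdiv_lt_0_compat; nra).
set (b := 2 * M0 * exp (T * (M0 + (mu + nu))) * T).
assert (Hb : 0 < b)
  by (unfold b; apply Rmult_lt_0_compat;
      [apply Rmult_lt_0_compat; [lra | apply exp_pos] | lra]).
exists (b + 1); split; [lra | ].
intros x1 x2 x3 k1 k2 k3 HE HB t Ht.
pose proof (emission_bound _ _ _ _ _ _ _ _ _ _ Hl Hmu Hnu HT HE) as Hem.
pose proof (extremal_reduces _ _ _ _ _ _ _ _ _ _ HT HE) as HR.
cbv zeta in Hem; fold c in HR.
set (M := mu * exp (k2 0) + nu * exp (2 * k3 0)) in *.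
assert (HM : 0 < M).
{ unfold M; apply Rplus_lt_0_compat; apply Rmult_lt_0_compat;
    auto using exp_pos. }
(* M <= M0 would contradict the emission bound, which increases with M. *)
assert (HMM : M0 < M).
{ apply Rnot_le_lt; intros Hle.
  assert (2 * M * exp (T * (M + (mu + nu))) * T <= b); [ | lra].
  unfold b; apply Rmult_le_compat_r; [lra | ].
  apply Rmult_le_compat; [lra | apply Rlt_le, exp_pos | lra | ].
  apply exp_le; nra. }
set (r := sqrt (lambda * M)).
assert (Hrr : r * r = lambda * M) by (apply sqrt_sqrt; nra).
assert (Hr : r0 < r).
{ assert (0 <= r) by apply sqrt_pos.
  assert (r0 * r0 < r * r); [ | nra].
  rewrite Hrr; replace (r0 * r0) with (lambda * M0) by (unfold M0; field; lra).
  apply Rmult_lt_compat_l; assumption. }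
assert (EM : M = r * r / lambda) by (rewrite Hrr; field; lra).
rewrite EM in HR.
assert (Hr' : 0 < r) by lra.
assert (Hc : 0 <= lambda + c) by (unfold c; lra).
pose proof (X_deviation_bound _ _ _ _ _ _ _ Hl Hr' Hc Hal HR t Ht) as HX.
fold C in HX; simpl in HX; rewrite clamp_id in HX by lra.
assert (HCr : C / r < eps * eps).
{ apply Rmult_lt_reg_r with r; [lra | ].
  replace (C / r * r) with C by (field; lra).
  replace C with (eps * eps * r0) by (unfold r0; field; lra).
  apply Rmult_lt_compat_l; [nra | exact Hr]. }
apply Rabs_def1; nra.
Qed.
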